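(* $$\lim_{\beta\nearrow 2}\dim_{H}\Big(\Big\{x\in\Big[0,\frac{1}{\beta-1}\Big]: x \text{ has no simply normal } \beta\text{-expansion}\Big\}\Big)=1.$$
   Context: For $\beta\in(1,2)$ and $x\in\mathbb{R}$, a sequence $(\epsilon_i)_{i\ge1}\in\{0,1\}^{\mathbb{N}}$ is called a $\beta$-expansion of $x$ if $x=\sum_{i=1}^{\infty}\epsilon_i\beta^{-i}$; the numbers having a $\beta$-expansion are exactly those of $[0,\frac1{\beta-1}]$. A sequence $(\epsilon_i)\in\{0,1\}^{\mathbb{N}}$ is simply normal if $\lim_{n\to\infty}\frac{\#\{1\le i\le n:\epsilon_i=0\}}{n}$ exists and equals $1/2$. $\dim_H$ denotes Hausdorff dimension. *)

(* Defs.v *)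
From HB Require Import structures.
From mathcomp Require Import all_boot all_order all_algebra.
From mathcomp Require Import all_classical all_reals all_analysis.
Set Implicit Arguments.
Unset Strict Implicit.
Unset Printing Implicit Defensive.
Import Order.TTheory GRing.Theory Num.Theory.
Import numFieldNormedType.Exports.
Local Open Scope classical_set_scope.
Local Open Scope ring_scope.

(* Digit sequences are 0-based: [eps i] is the digit usually written
   epsilon_(i+1), with [true] for 1 and [false] for 0. *)
Definition is_beta_expansion (R : realType) (beta x : R) (eps : nat -> bool) :
    Prop :=
  series (fun i : nat => (eps i)%:R / beta ^+ i.+1) @ \oo --> x.

Definition simply_normal (R : realType) (eps : nat -> bool) : Prop :=
  (fun n : nat => #|[pred i : 'I_n | ~~ eps i]|%:R / n%:R : R) @ \oo -->
    (2^-1 : R).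

Definition no_simply_normal_expansion (R : realType) (beta : R) : set R :=
  [set x | 0 <= x <= (beta - 1)^-1 /\
    ~ exists eps, is_beta_expansion beta x eps /\ simply_normal R eps].

Section Hausdorff.
Variable R : realType.
Implicit Types (A : set R) (s d : R) (U : (set R)^nat).
Local Open Scope ereal_scope.

(* 0 is added to the set of distances so that [diam set0 = 0], not -oo. *)
Definition diam A : \bar R :=
  ereal_sup (0 |` [set `|x - y|%:E | x in A & y in A]).

Definition delta_cover d A U : Prop :=
  A `<=` \bigcup_i U i /\ forall i, diam (U i) <= d%:E.

(* Finite covers are padded with empty sets, which must contribute 0 even for
   [s = 0], whereas [poweR] has 0 `^ 0 = 1; hence the restricted sum. *)
Definition hausdorff_pre s d A : \bar R :=
  ereal_inf [set \sum_(i <oo | U i != set0) diam (U i) `^ s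
            | U in delta_cover d A].

Definition hausdorff_measure s A : \bar R :=
  ereal_sup [set hausdorff_pre s d A | d in [set d | (0 < d)%R]].

Definition hausdorff_dim A : \bar R :=
  ereal_inf [set s%:E | s in [set s | (0 <= s)%R /\ hausdorff_measure s A = 0]].

End Hausdorff.

(* Main.v *)
Require Import Defs.
From mathcomp Require Import all_boot all_order all_algebra.
From mathcomp Require Import all_classical all_reals all_analysis.
From mathcomp Require Import ring lra zify.
Set Implicit Arguments.
Unset Strict Implicit.
Import Order.TTheory GRing.Theory Num.Theory.
Import numFieldNormedType.Exports.
Local Open Scope classical_set_scope.
Local Open Scope ring_scope.

(** Every set in play is a bounded set of reals, so its dimension is at most 1.
For the lower bound, fix [r] and put [L = r + 5], [K = 2 * L].  An arbitrary
binary sequence is encoded block by block ([encode]): [r] free bits become [L]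
digits, namely a 0, a tag telling whether at least half of the bits are ones,
the bits themselves (complemented when they are not), and three ones.  The
complementation and the padding give every block more ones than zeros, so the
frequency of zeros stays away from 1/2 along the multiples of [L]
([encode_zeros], [scarce_zeros_not_simply_normal]).  Moreover every window of
[K] consecutive digits contains both a 0 and a 1.

If a sequence has this window property and [2 - beta <= 2 ^ (-K - 2)], then any
other sequence, whatever it is, that first differs from it at position [p] has
a value at distance at least [2 ^ - (p + K + 2)] ([value_separation]): at
[beta = 2] the only obstacle would be a constant tail, and the windows leave
enough room to absorb the overlap [(2 - beta) / (beta - 1)].  This single
estimate is used twice.  It shows that an encoded sequence is the unique
expansion of its value, which therefore has no simply normal expansion
([point_no_simply_normal]).  And it shows that the map [point], sending
[t] in [0, 1] to the value of the encoded binary digits of [t], satisfies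
[|t - u| <= C * |point t - point u| ^ s] for [s <= r / L] ([point_expanding]):
when [t] and [u] first differ in the [n]-th group of [r] bits, they are
[2 ^ - (n * r)]-close, while the encodings differ before position
[(n + 1) * L].

Any cover of the image of such a map pulls back to a cover of [0, 1] by sets
contained in intervals of length [2 * C * diam ^ s], so countable subadditivity
of Lebesgue measure makes the [s]-dimensional Hausdorff measure positive
([hausdorff_measure_gt0_expanding]).  Hence the dimension is at least
[r / (r + 5)] as soon as [beta] is close enough to 2, and [r] is arbitrary. *)

(** * Hausdorff measure and dimension on the line *)

Section HausdorffFacts.
Variable R : realType.
Implicit Types (A : set R) (s d : R) (U : (set R)^nat).
Local Open Scope ereal_scope.

Lemma diam_ge0 A : 0 <= diam A.
Proof. by apply: ereal_sup_ubound; left. Qed.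

Lemma dist_le_diam A x y : A x -> A y -> `|x - y|%:E <= diam A.
Proof.
by move=> Ax Ay; apply: ereal_sup_ubound; right; exists x => //; exists y.
Qed.

Lemma diam_itv_le (a h : R) :
  (0 <= h)%R -> diam `[a, (a + h)%R]%classic <= h%:E.
Proof.
move=> h0; apply/ereal_supP => _ [->|[x /= xa [y /= ya] <-]].
  by rewrite lee_fin.
rewrite lee_fin ler_norml.
move: xa ya; rewrite !in_itv /= => /andP[? ?] /andP[? ?].
by apply/andP; split; lra.
Qed.

Lemma hausdorff_measure_ge0 s A : 0 <= hausdorff_measure s A.
Proof.
apply: (@le_trans _ _ (hausdorff_pre s 1 A)).
  apply/ereal_infP => _ [U _ <-].
  by apply: nneseries_ge0 => *; exact: poweR_ge0.
by apply: ereal_sup_ubound; exists 1%R => //=.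
Qed.

(** A cover [U] of [A] yields a cover of [0, 1]: if [U i] contains [g t], all the
points sent into [U i] are within [C * diam (U i) `^ s] of [t].  Comparing with
the Lebesgue measure of [0, 1] bounds the Hausdorff sum below by
[(2 * C)^-1]. *)
Lemma hausdorff_measure_gt0_expanding s (C : R) A (g : R -> R) :
  (0 <= s)%R -> (0 < C)%R ->
  (forall t, (0 <= t <= 1)%R -> A (g t)) ->
  (forall t u, (0 <= t <= 1)%R -> (0 <= u <= 1)%R ->
    (`|t - u| <= C * `|g t - g u| `^ s)%R) ->
  0 < hausdorff_measure s A.
Proof.
move=> s0 C0 gA gC.
apply: (@lt_le_trans _ _ ((2 * C)^-1)%:E).
  by rewrite lte_fin invr_gt0 mulr_gt0.
apply: (@le_trans _ _ (hausdorff_pre s 1 A)); last first.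
  by apply: ereal_sup_ubound; exists 1%R => //=.
apply/ereal_infP => _ [U [AU dU] <-].
rewrite -[_%:E]mule1 lee_pdivrMl ?mulr_gt0//.
rewrite -nneseriesZl; last by move=> *; exact: poweR_ge0.
rewrite eseries_mkcond.
(* [J i] is an interval containing the preimage of [U i], empty if the
   preimage is. *)
have /choice[J HJ] : forall i, exists J : set R,
  [/\ measurable J,
    lebesgue_measure J <=
      (if U i != set0 then (2 * C)%:E * diam (U i) `^ s else 0)
    & forall t, (0 <= t <= 1)%R -> U i (g t) -> J t].
  move=> i.
  have dfin : diam (U i) = (fine (diam (U i)))%:E.
    rewrite fineK// ge0_fin_numE ?diam_ge0//.
    by apply: le_lt_trans (dU i) _; rewrite ltry.
  have [[t [t01 Ut]]|noU] := pselect (exists t, (0 <= t <= 1)%R /\ U i (g t)).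
    pose e := (C * fine (diam (U i)) `^ s)%R.
    have e0 : (0 <= e)%R by rewrite mulr_ge0 ?powR_ge0// ltW.
    exists `[(t - e)%R, (t + e)%R]%classic; split.
    - exact: measurable_itv.
    - have -> : U i != set0 by apply/set0P; exists (g t).
      rewrite lebesgue_measure_itv /= dfin poweR_EFin -EFinM -mulrA -/e.
      case: ifP => _; last by rewrite lee_fin mulr_ge0.
      by rewrite -EFinB lee_fin; lra.
    - move=> u u01 Uu; rewrite /= in_itv /= -ler_distlC.
      apply: (le_trans (gC _ _ t01 u01)); rewrite ler_pM2l//.
      apply: ge0_ler_powR => //; rewrite ?nnegrE//.
        by rewrite fine_ge0// diam_ge0.
      by rewrite -lee_fin -dfin; exact: dist_le_diam.
  exists set0; split => //.
  - rewrite measure0; case: ifP => // _.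
    by rewrite mule_ge0 ?poweR_ge0// lee_fin mulr_ge0// ltW.
  - by move=> u u01 Uu; apply: noU; exists u.
apply: (@le_trans _ _ (\sum_(i <oo) lebesgue_measure (J i))); last first.
  by apply: lee_nneseries => // i _; case: (HJ i).
have -> : 1 = lebesgue_measure (`[0%R, 1%R]%classic : set R).
  by rewrite lebesgue_measure_itv /= lte_fin ltr01 oppr0 adde0.
apply: measure_sigma_subadditive => //.
- by move=> i; case: (HJ i).
- move=> t; rewrite /= in_itv /= => t01; have [i _ Ui] := AU _ (gA _ t01).
  by exists i => //; case: (HJ i) => _ _; apply.
Qed.

(** About [M / h] intervals of length [h] cover [A], and their sum
[(M / h + 1) * h `^ s <= (M + 1) * h `^ (s - 1)] tends to 0 with [h]. *)
Lemma hausdorff_measure_bounded_eq0 s (M : R) A :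
  (1 < s)%R -> A `<=` `[0%R, M]%classic -> hausdorff_measure s A = 0.
Proof.
move=> s1 AM; apply/eqP; rewrite eq_le hausdorff_measure_ge0 andbT.
apply/ereal_supP => _ [d /= d0 <-].
apply/lee_addgt0Pr => e e0; rewrite add0e.
have [M0|/lt_geF Mlt0] := leP 0%R M; last first.
  have A0 : A = set0.
    by apply/seteqP; split=> // x /AM; rewrite /= in_itv/= => /andP[/le_trans h /h];
      rewrite Mlt0.
  rewrite A0; apply: ge_ereal_inf; exists 0; last by rewrite lee_fin ltW.
  exists (fun=> set0); last by apply: eseries0 => i _; rewrite eqxx.
  split=> // i; apply/ereal_supP => _ [->|[x //]]; rewrite lee_fin ltW//.
(* The third bound is the solution of [(M + 1) * h `^ (s - 1) = e]. *)
pose h := (Num.min (Num.min d 1%R) ((e / (M + 1)) `^ (s - 1)^-1))%R.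
have M1 : (0 < M + 1)%R by lra.
have s10 : (0 < s - 1)%R by rewrite subr_gt0.
have h0 : (0 < h)%R by rewrite !lt_min d0 ltr01 powR_gt0// divr_gt0.
have hd : (h <= d)%R by rewrite /h !ge_min lexx.
have h1 : (h <= 1)%R by rewrite /h !ge_min lexx !orbT.
have he : ((M + 1) * h `^ (s - 1) <= e)%R.
  rewrite mulrC -ler_pdivlMr//.
  have -> : (e / (M + 1) = (e / (M + 1)) `^ (s - 1)^-1 `^ (s - 1))%R.
    by rewrite -powRrM mulVf ?gt_eqF// powRr1// ltW// divr_gt0.
  apply: ge0_ler_powR; rewrite ?nnegrE ?(ltW h0) ?powR_ge0 ?(ltW s10)//.
  by rewrite /h ge_min lexx !orbT.
pose n := (Num.truncn (M / h)).+1.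
pose U i : set R :=
  if (i < n)%N then `[(i%:R * h)%R, (i%:R * h + h)%R]%classic else set0.
have dU i : diam (U i) <= h%:E.
  rewrite /U; case: ifP => _; first by apply: diam_itv_le; exact: ltW.
  by apply/ereal_supP => _ [->|[x //]]; rewrite lee_fin ltW.
apply: ge_ereal_inf; exists (\sum_(i <oo | U i != set0) diam (U i) `^ s).
  exists U => //; split.
    move=> x /AM; rewrite /= in_itv/= => /andP[x0 xM].
    have xh0 : (0 <= x / h)%R by rewrite divr_ge0// ltW.
    exists (Num.truncn (x / h)) => //; rewrite /U ifT.
      rewrite /= in_itv/=; have := truncn_itv xh0.
      rewrite ler_pdivlMr// ltr_pdivrMr// -natr1 mulrDl mul1r => /andP[-> /ltW->//].
    by rewrite /n ltnS; apply: le_truncn; rewrite ler_pM2r ?invr_gt0.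
  by move=> i; apply: le_trans (dU i) _; rewrite lee_fin.
rewrite eseries_mkcond (nneseries_split 0 n); last first.
  by move=> i _; case: ifP => // _; exact: poweR_ge0.
rewrite add0n [X in _ + X]eseries0 ?adde0; last first.
  by move=> i ni _; rewrite /U ltnNge ni /= eqxx.
apply: (@le_trans _ _ (\sum_(0 <= i < n) (h `^ s)%:E)).
  apply: lee_sum => i _; case: ifP => _; last by rewrite lee_fin powR_ge0.
  rewrite -poweR_EFin; apply: gt0_ler_poweR => //.
  - by rewrite ltW// (lt_trans _ s1).
  - by rewrite in_itv /= diam_ge0 leey.
  - by rewrite in_itv /= lee_fin ltW//= leey.
rewrite sumEFin lee_fin sumr_const_nat subn0 -mulr_natl.
apply: le_trans he.
have -> : (h `^ s = h * h `^ (s - 1))%R.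
  by rewrite -{2}(powRr1 (ltW h0)) -powRD; [congr (_ `^ _)%R; ring|
    apply/implyP=> _; rewrite gt_eqF].
rewrite mulrA ler_wpM2r ?powR_ge0// /n -natr1 mulrDl mul1r lerD//.
by rewrite -ler_pdivlMr// truncn_le// divr_ge0// ltW.
Qed.

Lemma hausdorff_dim_bounded_le1 (M : R) A :
  A `<=` `[0%R, M]%classic -> hausdorff_dim A <= 1.
Proof.
move=> AM; apply/lee_addgt0Pr => e e0; apply: ereal_inf_lbound.
exists (1 + e)%R => //; split; first by lra.
by apply: hausdorff_measure_bounded_eq0 AM; lra.
Qed.

End HausdorffFacts.

(** * Binary digits *)

Section BinaryDigits.
Variable R : realType.
Implicit Types t u : R.

(** The orbit of [t] under the doubling map, in the version that keeps [0, 1]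
stable with both endpoints: the orbit of 1 is constant. *)
Fixpoint doubling (t : R) (n : nat) : R :=
  if n is m.+1 then 2 * doubling t m - (2^-1 <= doubling t m)%R%:R else t.

Definition bit t n : bool := 2^-1 <= doubling t n.

Lemma doubling_itv t n : 0 <= t <= 1 -> 0 <= doubling t n <= 1.
Proof.
move=> t01; elim: n => [|n]; rewrite ?t01 //= => /andP[? ?].
by have [?|?] := leP 2^-1 (doubling t n); rewrite /=; apply/andP; split; lra.
Qed.

(** As long as the bits agree, each doubling step multiplies [t - u] by exactly
2, and the orbits stay in [0, 1]. *)
Lemma bit_agree_dist t u n : 0 <= t <= 1 -> 0 <= u <= 1 ->
  (forall i, (i < n)%N -> bit t i = bit u i) -> `|t - u| <= 2^-1 ^+ n.
Proof.
move=> t01 u01 tu.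
have dE : doubling t n - doubling u n = 2 ^+ n * (t - u).
  elim: n tu => [|n IH] tu; first by rewrite expr0 mul1r.
  rewrite /= -/(bit t n) -/(bit u n) tu// exprS -mulrA -IH; first by ring.
  by move=> i ni; apply: tu; rewrite ltnS ltnW.
rewrite exprVn -div1r ler_pdivlMr ?exprn_gt0// mulrC.
rewrite -[2 ^+ n]gtr0_norm ?exprn_gt0// -normrM -dE ler_norml.
have /andP[? ?] := doubling_itv n t01; have /andP[? ?] := doubling_itv n u01.
by apply/andP; split; lra.
Qed.

End BinaryDigits.

(** * Separation of values of digit sequences *)

Section Expansions.
Variables (R : realType) (beta : R).
Hypothesis beta1 : 1 < beta.
Implicit Types d e : nat -> bool.

Let beta0 : 0 < beta. Proof. exact: lt_trans beta1. Qed.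

Definition psum d := series (fun i : nat => (d i)%:R / beta ^+ i.+1 : R).

Definition value d : R := limn (psum d).

Lemma sum_weights m n : (m <= n)%N ->
  \sum_(m <= i < n) (beta ^+ i.+1)^-1 <= (beta ^+ m)^-1 / (beta - 1).
Proof.
move=> /subnKC <-; move: (n - m)%N => k.
suff -> : \sum_(m <= i < m + k) (beta ^+ i.+1)^-1 =
   ((beta ^+ m)^-1 - (beta ^+ (m + k))^-1) / (beta - 1).
  by rewrite ler_pM2r ?invr_gt0 ?subr_gt0// gerBl invr_ge0 exprn_ge0// ltW.
elim: k => [|k IH]; first by rewrite addn0 big_geq// subrr mul0r.
rewrite addnS big_nat_recr ?leq_addr//= IH exprS.
have ? : beta ^+ (m + k) != 0 by rewrite expf_neq0// gt_eqF.
have ? : beta ^+ m != 0 by rewrite expf_neq0// gt_eqF.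
by field; rewrite ?expf_neq0 ?(gt_eqF beta0) ?gt_eqF ?subr_gt0.
Qed.

Lemma psum_itv d n : 0 <= psum d n <= (beta - 1)^-1.
Proof.
rewrite /psum /series /= sumr_ge0/=; last first.
  by move=> i _; rewrite divr_ge0// exprn_ge0// ltW.
have := sum_weights (leq0n n); rewrite expr0 invr1 div1r; apply: le_trans.
apply: ler_sum => i _; rewrite ler_piMl ?invr_ge0 ?exprn_ge0 ?(ltW beta0)//.
by rewrite lern1 leq_b1.
Qed.

Lemma psum_cvg d : psum d @ \oo --> value d.
Proof.
apply: nondecreasing_is_cvgn.
  apply/nondecreasing_seqP => n; rewrite /psum /series /= big_nat_recr//= lerDl.
  by rewrite divr_ge0// exprn_ge0// ltW.
exists (beta - 1)^-1 => _ [n _ <-]; by case/andP: (psum_itv d n).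
Qed.

Lemma value_itv d : 0 <= value d <= (beta - 1)^-1.
Proof.
apply/andP; split.
  by apply: (cvgr_to_ge (@psum_cvg d)); near=> n; case/andP: (psum_itv d n).
by apply: (cvgr_to_le (@psum_cvg d)); near=> n; case/andP: (psum_itv d n).
Unshelve. all: by end_near. Qed.

(** After position [p] the worst case is that [d] has only zeros and [e] only
ones, which costs [(beta ^+ p.+1)^-1 / (beta - 1)]; the digit one of [d] at [i0]
saves the term of index [i0]. *)
Lemma psum_gap d e p i0 n : (p < i0 < n)%N ->
  (forall i, (i < p)%N -> d i = e i) -> d p -> ~~ e p -> d i0 ->
  (beta ^+ p.+1)^-1 + (beta ^+ i0.+1)^-1 - (beta ^+ p.+1)^-1 / (beta - 1)
    <= psum d n - psum e n.
Proof.
move=> /andP[pi0 i0n] dep dp ep di0.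
have pn : (p < n)%N by exact: ltn_trans i0n.
rewrite /psum /series /= -sumrB (big_cat_nat (n := p))//=; last exact: ltnW.
rewrite big_nat big1 ?add0r => [|i /andP[_ ip]]; last by rewrite dep// subrr.
rewrite big_ltn// dp (negbTE ep) mul0r subr0 div1r -addrA lerD2l.
apply: (@le_trans _ _ (\sum_(p.+1 <= i < n)
    ((i == i0)%:R / beta ^+ i.+1 - (beta ^+ i.+1)^-1))).
  rewrite sumrB lerB ?sum_weights//.
  rewrite (bigD1_seq i0) ?iota_uniq//=; last by rewrite mem_index_iota pi0.
  by rewrite eqxx div1r lerDl sumr_ge0// => i /negbTE ->; rewrite mul0r.
apply: ler_sum => i _.
rewrite -[X in _ - X]div1r -!mulrBl ler_pM2r ?invr_gt0 ?exprn_gt0//.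
by have [->|_] := eqVneq i i0; rewrite ?di0; case: (d i); case: (e _) => /=; lra.
Qed.

Definition bounded_runs (K : nat) d :=
  forall p (b : bool), exists2 i, (p < i <= p + K)%N & d i = b.

(** For [beta = 2] the gap of [psum_gap] reduces to the saved term, which is at
least [2 ^ - (p + 1 + K)]; the hypothesis on [2 - beta] makes the loss
[1 / (beta - 1) - 1] at most half of the corresponding factor [2 ^ - K].  The
sequence [e] is arbitrary, as uniqueness of expansions requires. *)
Lemma value_separation K d e p x y : beta < 2 -> 2 - beta <= 2^-1 ^+ K.+2 ->
  bounded_runs K d -> (forall i, (i < p)%N -> d i = e i) -> d p != e p ->
  psum d @ \oo --> x -> psum e @ \oo --> y ->
  2^-1 ^+ (p.+1 + K.+1) <= `|x - y|.
Proof.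
move=> beta2 betaK dK dep dep' dx ey.
have dey : (fun n => `|psum d n - psum e n|) @ \oo --> `|x - y|.
  by apply: cvg_norm; exact: cvgB.
apply: (cvgr_to_ge dey).
have [i0 /andP[pi0 i0K] di0] := dK p (d p).
exists i0.+1 => // n /= i0n.
have K1 : 2^-1 ^+ K <= 1 :> R by rewrite exprn_ile1 ?invr_ge0// invf_le1// ler1n.
have K0 : 0 < 2^-1 ^+ K :> R by rewrite exprn_gt0 ?invr_gt0.
have b32 : 2^-1 <= beta - 1 by move: betaK; rewrite !exprS; lra.
have powV k : 2^-1 ^+ k <= (beta ^+ k)^-1.
  rewrite exprVn lef_pV2 ?posrE ?exprn_gt0//.
  by apply: lerXn2r; rewrite ?nnegrE ltW.
have gap : 2^-1 ^+ (p.+1 + K.+1) <=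
    (beta ^+ p.+1)^-1 + (beta ^+ i0.+1)^-1 - (beta ^+ p.+1)^-1 / (beta - 1).
  apply: (@le_trans _ _ ((beta ^+ p.+1)^-1 *
      (1 + (beta ^+ K)^-1 - (beta - 1)^-1))); last first.
    rewrite mulrBr mulrDr mulr1 lerB// lerD2l -invfM -exprD.
    rewrite lef_pV2 ?posrE ?exprn_gt0//.
    by rewrite ler_weXn2l ?ltW// addSn ltnS.
  rewrite exprD; apply: ler_pM; rewrite ?exprn_ge0//.
  have Vb : (beta - 1)^-1 <= 1 + 2 * (2 - beta).
    have b10 : 0 < beta - 1 by lra.
    rewrite -div1r ler_pdivrMr//; nra.
  have := powV K; move: betaK; rewrite !exprS; lra.
apply: le_trans gap _.
case dpE : (d p) dep' di0 => dep' di0.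
  rewrite (le_trans _ (ler_norm _))//.
  by apply: psum_gap; rewrite ?dpE ?pi0//; move: dep'; case: (e p).
(* When [d p] is zero, exchange the roles of the two digits. *)
have psumC f : psum (negb \o f) n =
    \sum_(0 <= i < n) (beta ^+ i.+1)^-1 - psum f n.
  rewrite /psum /series /= -sumrB; apply: eq_bigr => i _ /=.
  by case: (f i); rewrite /= ?div1r ?mul0r ?subr0 ?subrr.
apply: (@le_trans _ _ (psum (negb \o d) n - psum (negb \o e) n)).
  apply: psum_gap; rewrite /= ?dpE ?di0 ?pi0//.
  by move=> i ip; rewrite dep.
by rewrite !psumC distrC (le_trans _ (ler_norm _))//; lra.
Qed.

End Expansions.

(** * Encoding free bits into blocks with few zeros *)

Section Encoding.
Variable r : nat.
Implicit Types a b : nat -> bool.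

Definition majority a q : bool := (r <= 2 * \sum_(0 <= k < r) a (q * r + k))%N.

(** The digits are [0, majority, r bits, 1, 1, 1].  The bits are complemented
when zeros prevail among them; the [majority] digit records this, so that the
bits can be recovered. *)
Definition block a q j : bool :=
  if j is j'.+1 then
    if j' is k.+1 then
      if (k < r)%N then a (q * r + k)%N (+) ~~ majority a q else true
    else majority a q
  else false.

Definition encode a i : bool := block a (i %/ (r + 5)) (i %% (r + 5)).

Lemma encode_block a q j : (j < r + 5)%N ->
  encode a (q * (r + 5) + j) = block a q j.
Proof.
move=> jL; rewrite /encode divnMDl ?modnMDl ?divn_small ?modn_small ?addn0//.
by lia.
Qed.

(** A window of length [2 * (r + 5)] contains a whole block, which starts with 0
and ends with 1. *)
Lemma encode_bounded_runs a : bounded_runs (2 * (r + 5)) (encode a).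
Proof.
move=> p b; pose q := (p %/ (r + 5)).+1.
have pq : (p < q * (r + 5) <= p + (r + 5))%N.
  by have := divn_eq p (r + 5); have := @ltn_pmod p (r + 5); rewrite /q; nia.
exists (q * (r + 5) + (if b then r + 4 else 0))%N; first by case: b; lia.
rewrite encode_block; last by case: b; lia.
by case: b; rewrite ?addn4//= ltnNge leqW ?leqW//.
Qed.

Lemma encode_inj_block a b q :
  (forall j, (j < r + 5)%N ->
    encode a (q * (r + 5) + j) = encode b (q * (r + 5) + j)) ->
  forall k, (k < r)%N -> a (q * r + k)%N = b (q * r + k)%N.
Proof.
move=> ab k kr.
have := ab 1%N; rewrite !encode_block/=; [move=> abm|lia|lia].
have := ab k.+2; rewrite !encode_block/= ?kr; [|lia|lia].
by rewrite abm; [move=> /(_ ltac:(lia))/addIb|lia].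
Qed.

(** At most half of the [r] transcribed bits are zeros; the leading digit and
the tag add at most two. *)
Lemma block_zeros a q : (2 * \sum_(0 <= j < r + 5) ~~ block a q j <= r + 4)%N.
Proof.
have -> : (r + 5 = (r + 3).+2)%N by lia.
rewrite !big_nat_recl//= (big_cat_nat (n := r))//=; last exact: leq_addr.
have -> : (\sum_(r <= k < r + 3) ~~ (if (k < r)%N then
    a (q * r + k)%N (+) ~~ majority a q else true) = 0)%N.
  by rewrite big_nat big1// => k /andP[/leq_gtF ->].
rewrite addn0.
have zerosE : (\sum_(0 <= k < r) a (q * r + k) +
    \sum_(0 <= k < r) ~~ a (q * r + k) = r)%N.
  rewrite -big_split/= -[RHS]muln1 -[in RHS](subn0 r) -sum_nat_const_nat.
  by apply: eq_bigr => k _; case: (a _).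
have -> : (\sum_(0 <= k < r) ~~ (if (k < r)%N then
      a (q * r + k)%N (+) ~~ majority a q else true) =
    if majority a q then \sum_(0 <= k < r) ~~ a (q * r + k)
    else \sum_(0 <= k < r) a (q * r + k))%N.
  case: ifP => maj; apply: eq_big_nat => k /andP[_ ->]/=; first by rewrite addbF.
  by rewrite addbT negbK.
by rewrite /majority in zerosE *; case: ifP => maj /=; lia.
Qed.

Lemma encode_zeros a n :
  (2 * \sum_(0 <= i < n * (r + 5)) ~~ encode a i <= n * (r + 4))%N.
Proof.
elim: n => [|n IH]; first by rewrite !mul0n big_geq.
rewrite (mulSnr n (r + 5)) (big_cat_nat (n := n * (r + 5)))//=; last exact: leq_addr.
rewrite mulnDr (mulSnr n (r + 4)) leq_add// -{1}[(n * (r + 5))%N]add0n big_addn addKn.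
rewrite (eq_big_nat _ _ (F2 := fun j => ~~ block a n j : nat)) ?block_zeros//.
by move=> j /andP[_ jL]; rewrite addnC encode_block.
Qed.

End Encoding.

(** Along the multiples of [L] the frequency of zeros is at most
[(L - 1) / (2 * L)], which is less than 1/2. *)
Lemma scarce_zeros_not_simply_normal (R : realType) (d : nat -> bool)
    (L : nat) :
  (0 < L)%N ->
  (forall n, (2 * \sum_(0 <= i < n * L) ~~ d i <= n * L.-1)%N) ->
  ~ simply_normal R d.
Proof.
move=> L0 zeros sn.
have L0R : 0 < L%:R :> R by rewrite ltr0n.
have cL : L.-1%:R / (2 * L%:R) < 2^-1 :> R.
  by rewrite invfM mulrCA gtr_pMr ?invr_gt0// ltr_pdivrMr// mul1r ltr_nat prednK.
have [N _ /(_ (N.+1 * L)%N)] := cvgr_gt _ sn _ cL.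
have NL : (N <= N.+1 * L)%N by rewrite (leq_trans (leqnSn N))// leq_pmulr.
move=> /(_ NL) /=; apply/negP; rewrite -leNgt.
rewrite -sum1_card big_mkcond /= -(big_mkord xpredT (fun i => ~~ d i : nat)).
rewrite natrM ler_pdivrMr ?mulr_gt0 ?ltr0n//.
have -> : L.-1%:R / (2 * L%:R) * (N.+1%:R * L%:R) = (N.+1 * L.-1)%:R / 2 :> R.
  by rewrite natrM; field; rewrite gt_eqF.
by rewrite ler_pdivlMr// -natrM ler_nat mulnC zeros.
Qed.

(** * The lower bound for the dimension *)

Section LowerBound.
Variables (R : realType) (beta : R) (r : nat).
Hypotheses (r0 : (0 < r)%N) (beta1 : 1 < beta) (beta2 : beta < 2).
Let K := (2 * (r + 5))%N.
Hypothesis betaK : 2 - beta <= 2^-1 ^+ K.+2.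

Definition point (t : R) : R := value beta (encode r (bit t)).

(** Two expansions of the same number are at distance 0, so [value_separation]
leaves the encoded sequence as the only expansion. *)
Lemma point_no_simply_normal t : no_simply_normal_expansion beta (point t).
Proof.
split; first exact: value_itv.
case=> e [ex sn].
have [eE|/existsNP[i0 Hi0]] := pselect (forall i, encode r (bit t) i = e i).
  move: sn; rewrite (_ : e = encode r (bit t)); last by apply/funext.
  apply: (@scarce_zeros_not_simply_normal R _ (r + 5)); first by lia.
  by move=> n; rewrite (_ : (r + 5).-1 = r + 4)%N ?encode_zeros//; lia.
have ex0 : exists i, encode r (bit t) i != e i by exists i0; apply/eqP.
case: (ex_minnP ex0) => p dp pmin.
have := value_separation beta1 beta2 betaK
  (@encode_bounded_runs r (bit t)) _ dp (@psum_cvg _ _ beta1 _) ex.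
rewrite subrr normr0 leNgt exprn_gt0 ?invr_gt0// => H.
suff: false by [].
by apply: H => i ip; apply/eqP/negPn/negP => /pmin; rewrite leqNgt ip.
Qed.

(** The critical exponent is the ratio of free bits to digits: if the first
difference is in the [n]-th group of bits, the distance of [t] and [u] is at most
[2 ^ - (n * r)], that of their images at least about
[2 ^ - ((n + 1) * (r + 5))], and the constant absorbs the shift from [n] to
[n + 1]. *)
Lemma point_expanding s t u : 0 <= s <= r%:R / (r + 5)%:R ->
  0 <= t <= 1 -> 0 <= u <= 1 ->
  `|t - u| <= 2 ^+ (r + K.+1) * `|point t - point u| `^ s.
Proof.
move=> /andP[s0 sr] t01 u01.
have [tu|/existsNP[i0 Hi0]] := pselect (forall i, bit t i = bit u i).
  suff : `|t - u| <= 0 by move=> h; rewrite (le_trans h)// mulr_ge0 ?powR_ge0.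
  have /cvgr_to_ge : (fun n => 2^-1 ^+ n : R) @ \oo --> (0 : R).
    by apply: cvg_expr; rewrite gtr0_norm ?invr_gt0// invf_lt1// ltr1n.
  by apply; near=> n; apply: bit_agree_dist.
have ex0 : exists i, bit t i != bit u i by exists i0; apply/eqP.
case: (ex_minnP ex0) => m dm mmin.
(* [n] is the index of the group of [r] bits containing the first difference. *)
have [n mE] : exists n, m = (n * r + m %% r)%N by exists (m %/ r)%N; exact: divn_eq.
have tun : `|t - u| <= 2^-1 ^+ (n * r).
  apply: bit_agree_dist => // i inr; apply/eqP/negPn/negP => /mmin mi.
  by have := leq_trans inr (leq_trans (leq_addr (m %% r) _) (leq_trans _ mi));
    rewrite -mE ltnn => /(_ (leqnn m)).
have ex1 : exists i, (encode r (bit t) i != encode r (bit u) i) &&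
    (i < n.+1 * (r + 5))%N.
  apply: contrapT => /forallNP noi.
  have : bit t (n * r + m %% r) = bit u (n * r + m %% r).
    apply: encode_inj_block; last by rewrite ltn_mod.
    move=> j jL; apply/eqP/negPn/negP => dj; apply: (noi (n * (r + 5) + j)%N).
    by rewrite dj /= mulSnr ltn_add2l.
  by move/eqP: dm; rewrite -mE.
case: (ex_minnP ex1) => p /andP[dp pL] pmin.
have sep : 2^-1 ^+ (n.+1 * (r + 5) + K.+1) <= `|point t - point u|.
  apply: (@le_trans _ _ (2^-1 ^+ (p.+1 + K.+1))).
    by rewrite ler_wiXn2l ?invr_ge0// ?invf_le1// ?ler1n// leq_add2r.
  apply: (value_separation beta1 beta2 betaK
    (@encode_bounded_runs r (bit t)) _ dp (@psum_cvg _ _ beta1 _)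
    (@psum_cvg _ _ beta1 _)) => i ip.
  apply/eqP/negPn/negP => di.
  by have := pmin i; rewrite di (ltn_trans ip pL) leqNgt ip => /(_ isT).
apply: (le_trans tun).
have -> : 2^-1 ^+ (n * r) = 2 ^+ (r + K.+1) * 2^-1 ^+ (n.+1 * r + K.+1) :> R.
  have -> : (n.+1 * r + K.+1 = (r + K.+1) + n * r)%N by rewrite mulSn addnAC.
  by rewrite (exprD 2^-1 (r + K.+1) (n * r)) mulrA -exprMn divff// expr1n mul1r.
rewrite ler_pM2l ?exprn_gt0//.
have half0 : 0 < 2^-1 :> R by rewrite invr_gt0.
apply: (@le_trans _ _ ((2^-1 ^+ (n.+1 * (r + 5) + K.+1)) `^ s)); last first.
  by apply: ge0_ler_powR => //; rewrite nnegrE ?exprn_ge0 ?(ltW half0).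
rewrite -!powR_mulrn ?(ltW half0)// -powRrM.
apply: ger_powR; first by rewrite half0 invf_le1// ler1n.
have L0 : 0 < (r + 5)%:R :> R by rewrite ltr0n addnS.
have s1 : s <= 1.
  by rewrite (le_trans sr)// ler_pdivrMr// mul1r ler_nat leq_addr.
rewrite natrD mulrDl natrD lerD//; last by rewrite ler_piMr.
rewrite !natrM -mulrA ler_wpM2l// mulrC -ler_pdivlMr//.
Unshelve. all: by end_near. Qed.

Lemma hausdorff_dim_ge :
  ((r%:R / (r + 5)%:R)%:E <= hausdorff_dim (no_simply_normal_expansion beta))%E.
Proof.
apply/ereal_infP => _ [s [s0 Hs] <-]; rewrite lee_fin leNgt; apply/negP => sr.
suff : (0 < hausdorff_measure s (no_simply_normal_expansion beta))%E.
  by rewrite Hs ltxx.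
apply: (@hausdorff_measure_gt0_expanding _ _ (2 ^+ (r + K.+1)) _ point) => //.
- by move=> t _; exact: point_no_simply_normal.
- by move=> t u t01 u01; apply: point_expanding => //; rewrite s0 ltW.
Qed.

End LowerBound.

Theorem theorem2p2 (R : realType) :
  hausdorff_dim (no_simply_normal_expansion beta) @[beta --> (2 : R)^'-]
    --> (1 : \bar R)%E.
Proof.
have le1 : \forall beta \near (2 : R)^'-,
    (hausdorff_dim (no_simply_normal_expansion beta) <= 1)%E.
  near=> beta.
  apply: (@hausdorff_dim_bounded_le1 _ (beta - 1)^-1) => x [/andP[x0 x1] _].
  by rewrite /= in_itv /= x0.
have ge r : (0 < r)%N -> \forall beta \near (2 : R)^'-,
    ((r%:R / (r + 5)%:R)%:E <=
      hausdorff_dim (no_simply_normal_expansion beta))%E.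
  move=> r0; near=> beta.
  apply: hausdorff_dim_ge => //.
  - by near: beta; apply: nbhs_left_gt; rewrite ltr1n.
  - apply: ltW; near: beta; apply: nbhs_left_ltBl.
    by rewrite exprn_gt0// invr_gt0.
have geN (c : R) : c < 1 -> \forall beta \near (2 : R)^'-,
    (c%:E <= hausdorff_dim (no_simply_normal_expansion beta))%E.
  move=> c1.
  (* r / (r + 5) = 1 - 5 / (r + 5) is at least c once r >= 5 / (1 - c). *)
  pose r := (Num.truncn (5 / (1 - c))).+1.
  have c10 : 0 < 1 - c by rewrite subr_gt0.
  have rc : 5 < r%:R * (1 - c).
    rewrite -ltr_pdivrMr// /r.
    by have /andP[] := truncn_itv (divr_ge0 (ler0n R 5) (ltW c10)).
  apply: filterS (ge r isT) => beta; apply: le_trans.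
  rewrite lee_fin ler_pdivlMr; last by rewrite ltr0n addnS.
  rewrite natrD; nra.
apply/fine_cvgP; split.
  near=> beta; rewrite fin_numE; apply/andP; split.
    rewrite -ltNye; apply: lt_le_trans (ltNyr 0) _.
    by near: beta; apply: geN.
  rewrite -ltey; apply: le_lt_trans (ltry 1).
  by near: beta.
apply/cvgrPdist_le => eps eps0; near=> beta.
have dge : ((1 - eps)%:E <= hausdorff_dim (no_simply_normal_expansion beta))%E.
  by near: beta; apply: geN; rewrite ltrBlDr ltrDl.
have dle : (hausdorff_dim (no_simply_normal_expansion beta) <= 1)%E.
  by near: beta.
rewrite /=; case: (hausdorff_dim _) dge dle => [x| |]//=.
rewrite !lee_fin => x1 x2; rewrite ger0_norm ?subr_ge0//; lra.
Unshelve. all: by end_near. Qed.
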